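(* The torsion-free $G_2$-structure in $\mathcal M_1$ is unique up to diffeomorphism. Specifically, if $\varphi(t)$, $t\in[0,1]$, is a canonical geodesic in $\mathcal M_1$ and $\varphi(0)$, $\varphi(1)$ are both torsion-free, then the geodesic $\varphi(t)$ is generated by orientation-preserving diffeomorphisms: there are orientation-preserving diffeomorphisms $\sigma_t$ of $S^1$ with $u(\cdot,t)=u(\cdot,0)\circ\sigma_t$ for all $t\in[0,1]$.
   Context: $S^1=\mathbb R/\mathbb Z$ (unit length) with coordinate $x=x_0$. $\mathcal M_1$ is the space of closed $G_2$-structures $\varphi_u=d\theta^{123}-d\theta^1\wedge(dx^{01}+dx^{23})-d\theta^2\wedge(dx^{02}+dx^{31})-d\theta^3\wedge(u\,dx^{03}+dx^{12})$ on $\mathbb T^7=\mathbb T^3\times\mathbb T^4$, with $u=u(x_0)>0$ smooth and $\int_{S^1}u=1$. $\varphi$ is torsion-free if $d\varphi=0$ and $d*_\varphi\varphi=0$. For a smooth zero-mean function $f$ on $S^1$ with $F(x)=\int_0^xf$, $Q(f)=F-\big[\int_{S^1}u^{-1}F\big]\big[\int_{S^1}u^{-1}\big]^{-1}$. A canonical geodesic is a smooth path $\varphi_{u(t)}$ such that, with $f=u_t$, $Q(f)_t=\frac{Q(f)f}{u}+\frac u2\big[\frac{Q(f)^2}{u^2}\big]_x$. *)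

(* Defs.v *)
From HB Require Import structures.
From mathcomp Require Import all_boot all_order all_algebra.
From mathcomp Require Import all_classical all_reals all_analysis.
Set Implicit Arguments.
Unset Strict Implicit.
Unset Printing Implicit Defensive.
Import Order.TTheory GRing.Theory Num.Theory.
Import numFieldNormedType.Exports.
Local Open Scope ring_scope.

Section Smooth.
Context {R : realType} {V W : normedModType R}.

(* class C^k, through iterated directional derivatives *)
Fixpoint class_C (k : nat) (f : V -> W) : Prop :=
  if k is k'.+1 then
    (forall x, differentiable f x) /\ (forall v, class_C k' ('D_v f))
  else continuous f.

Definition smooth (f : V -> W) : Prop := forall k, class_C k f.

End Smooth.

(* The exterior algebra of (R^n)^*: an element is given by its coefficients on
   the monomials dx^I = dx^{i_1} /\ ... /\ dx^{i_k}, I = {i_1 < ... < i_k}. *)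
Notation ext R n := {ffun {set 'I_n} -> R^o}.

Section Exterior.
Context {R : realType} {n : nat}.

(* dx^I /\ dx^J = shuffle_sign I J *: dx^(I :|: J) for disjoint I and J *)
Definition shuffle_sign (I J : {set 'I_n}) : R :=
  (-1) ^+ #|[set ij : 'I_n * 'I_n |
              [&& ij.1 \in I, ij.2 \in J & (ij.2 < ij.1)%N]]|.

Definition wedge (a b : ext R n) : ext R n :=
  [ffun K : {set 'I_n} => \sum_(I : {set 'I_n} | I \subset K)
     shuffle_sign I (K :\: I) * a I * b (K :\: I)].

Definition dcoord (i : 'I_n) : ext R n :=
  [ffun I : {set 'I_n} => (I == [set i])%:R].

(* interior product with the i-th coordinate vector *)
Definition interior_prod (i : 'I_n) (a : ext R n) : ext R n :=
  [ffun I : {set 'I_n} =>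
     if i \in I then 0 else shuffle_sign [set i] I * a (i |: I)].

(* the minor of M with rows I and columns J; 0 if #|I| and #|J| differ *)
Definition minor (M : 'M[R]_n) (I J : {set 'I_n}) : R :=
  match #|I| =P #|J| with
  | ReflectT eqIJ =>
      \det (\matrix_(a < #|I|, b < #|I|)
              M (enum_val a) (enum_val (cast_ord eqIJ b)))
  | ReflectF _ => 0
  end.

(* The Hodge star of the metric g and the volume form v dx^{0 ... n-1}:
   it is determined by a /\ hodge g v b = <a, b>_g v dx^{0 ... n-1}, where
   <dx^I, dx^J>_g is the minor of g^-1 with rows I and columns J. *)
Definition hodge (g : 'M[R]_n) (v : R) (b : ext R n) : ext R n :=
  [ffun K : {set 'I_n} => shuffle_sign (~: K) K * v *
     \sum_(J : {set 'I_n}) minor (invmx g) (~: K) J * b J].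

End Exterior.

Infix "/\w" := wedge (at level 40, left associativity) : ring_scope.

(* Functions, forms and maps on the torus R^n / Z^n are given by their lifts to
   R^n; the forms are those whose coefficients are Z^n-periodic. *)
Section Forms.
Context {R : realType} {n : nat}.

Definition torus_form : Type := 'rV[R]_n.+1 -> ext R n.+1.

Definition d_ext (w : torus_form) : torus_form := fun p =>
  [ffun K : {set 'I_n.+1} => \sum_(i in K)
     shuffle_sign [set i] (K :\ i) *
     'D_(delta_mx ord0 i) (fun q => w q (K :\ i)) p].

(* rows are indexed by the components of S: the transpose of the row-vector
   convention of the library's jacobian *)
Definition jacobian_mx (S : 'rV[R]_n.+1 -> 'rV[R]_n.+1) (p : 'rV[R]_n.+1) :
    'M[R]_n.+1 :=
  \matrix_(j, i) ('D_(delta_mx ord0 i) S p) ord0 j.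

(* S^* dx^J = dS_{j_1} /\ ... /\ dS_{j_k} has coefficients the minors of the
   Jacobian matrix with rows J *)
Definition pullback (S : 'rV[R]_n.+1 -> 'rV[R]_n.+1) (w : torus_form) :
    torus_form := fun p =>
  [ffun I : {set 'I_n.+1} =>
     \sum_(J : {set 'I_n.+1}) minor (jacobian_mx S p) J I * w (S p) J].

Definition lattice (p : 'rV[R]_n.+1) : Prop := forall i, p ord0 i \is a Num.int.

Definition torus_map (S : 'rV[R]_n.+1 -> 'rV[R]_n.+1) : Prop :=
  smooth S /\ forall p q, lattice (q - p) -> lattice (S q - S p).

Definition torus_diffeo (S : 'rV[R]_n.+1 -> 'rV[R]_n.+1) : Prop :=
  torus_map S /\
  exists2 T : 'rV[R]_n.+1 -> 'rV[R]_n.+1, torus_map T & cancel S T /\ cancel T S.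

End Forms.
Arguments torus_form : clear implicits.

Section G2.
Context {R : realType}.

(* The metric g and volume form v dx^{0 ... 6} of a G_2-structure phi satisfy
     g_ij v dx^{0 ... 6} = 1/6 (i_{e_i} phi) /\ (i_{e_j} phi) /\ phi
   and v ^+ 2 = det g.  With B = g_ij v this gives det B = v ^+ 9, so that v is
   the real ninth root of det B; its sign is the orientation given by phi. *)
Definition g2_bilin (phi : ext R 7) : 'M[R]_7 :=
  \matrix_(i, j) (6^-1 * (interior_prod i phi /\w interior_prod j phi /\w phi)
                     [set: 'I_7]).

Definition g2_vol (phi : ext R 7) : R :=
  Num.sg (\det (g2_bilin phi)) * `|\det (g2_bilin phi)| `^ (9^-1).

Definition g2_metric (phi : ext R 7) : 'M[R]_7 :=
  (g2_vol phi)^-1 *: g2_bilin phi.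

Definition g2_star (phi : ext R 7) : ext R 7 -> ext R 7 :=
  hodge (g2_metric phi) (g2_vol phi).

Definition torsion_free (phi : torus_form R 6) : Prop :=
  d_ext phi = (fun=> 0) /\ d_ext (fun p => g2_star (phi p) (phi p)) = (fun=> 0).

(* The coordinates of T^7 = T^3 x T^4 are ordered as
   (theta^1, theta^2, theta^3, x_0, x_1, x_2, x_3). *)
Definition dtheta (i : nat) : ext R 7 := dcoord (inord i.-1).
Definition dx (i : nat) : ext R 7 := dcoord (inord (3 + i)).

Definition phi_of (u : R -> R) : torus_form R 6 := fun p =>
  dtheta 1 /\w dtheta 2 /\w dtheta 3
  - dtheta 1 /\w (dx 0 /\w dx 1 + dx 2 /\w dx 3)
  - dtheta 2 /\w (dx 0 /\w dx 2 + dx 3 /\w dx 1)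
  - dtheta 3 /\w (u (p ord0 (inord 3)) *: (dx 0 /\w dx 3) + dx 1 /\w dx 2).

End G2.

Section Geodesics.
Context {R : realType}.

Local Open Scope classical_set_scope.

Local Notation mu := (@lebesgue_measure R).

(* Functions on S^1 = R / Z are 1-periodic functions on R. *)
Definition int_S1 (f : R -> R) : R := \int[mu]_(x in `[0, 1]) f x.

(* the oriented integral of f from 0 to x; at most one of the two intervals
   has nonzero length *)
Definition int_from0 (f : R -> R) (x : R) : R :=
  \int[mu]_(y in `[0, x]) f y - \int[mu]_(y in `[x, 0]) f y.

(* phi_of u belongs to M_1 *)
Definition in_M1 (u : R -> R) : Prop :=
  [/\ smooth u, forall x, u (x + 1) = u x, forall x, 0 < u x & int_S1 u = 1].

Definition Qop (u f : R -> R) (x : R) : R :=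
  int_from0 f x
  - int_S1 (fun y => (u y)^-1 * int_from0 f y) * (int_S1 (fun y => (u y)^-1))^-1.

Definition dt (u : R -> R -> R) (t x : R) : R := derive1 (fun s => u s x) t.

(* A path u t x, smooth for t in [0, 1] up to the end points, is given as the
   restriction to t in [0, 1] of a smooth function on R * R; the t-derivatives
   at t = 0 and t = 1 are then determined by the restriction, by continuity. *)
Definition canonical_geodesic (u : R -> R -> R) : Prop :=
  [/\ smooth (fun p : R * R => u p.1 p.2),
      forall t, 0 <= t <= 1 -> in_M1 (u t) &
      forall t x, 0 <= t <= 1 ->
        derive1 (fun s => Qop (u s) (dt u s) x) t =
        Qop (u t) (dt u t) x * dt u t x / u t x
        + u t x / 2 *
          derive1 (fun y => Qop (u t) (dt u t) y ^+ 2 / u t y ^+ 2) x].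

(* lifts to R of smooth maps of degree 1 from S^1 to itself *)
Definition S1_map_deg1 (s : R -> R) : Prop :=
  smooth s /\ forall x, s (x + 1) = s x + 1.

Definition S1_diffeo_op (s : R -> R) : Prop :=
  [/\ S1_map_deg1 s, forall x, 0 < derive1 s x &
      exists2 r : R -> R, S1_map_deg1 r & cancel s r /\ cancel r s].

End Geodesics.

(* Main.v *)
(* The coefficient of *phi_u on dtheta^{23} /\ dx^{23} is u^{1/3} up to sign, so
   d*phi_u = 0 forces u to be constant, hence u = 1: the identity of T^7 relates
   two torsion-free structures of M_1.

   Along a canonical geodesic, h = Q(u_t) / u satisfies Burgers' equation
   h_t = h h_x while u_t = (u h)_x.  Hence h is constant on the characteristics
   X(t, y) = y - t h(0, y), and u is transported as a density:
   u(t, X(t, y)) (1 - t h_x(0, y)) = u(0, y).  With u(0) = u(1) = 1 this yields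
   h_x(0, .) = 0 at t = 1, then u_t(0, .) = 0, h(0, .) = 0, and finally h = 0 and
   u_t = 0 for all t: the geodesic is constant and sigma_t = id. *)

Require Import Defs.
From mathcomp Require Import all_boot all_order all_algebra.
From mathcomp Require Import all_classical all_reals all_analysis.
From mathcomp Require Import ring lra.
Import Order.TTheory GRing.Theory Num.Theory.
Import numFieldNormedType.Exports.
Local Open Scope ring_scope.
Set Implicit Arguments.
Unset Strict Implicit.
Unset Printing Implicit Defensive.

(** * Minors of diagonal matrices *)

Section Minors.
Import mathcomp.boot.fintype mathcomp.boot.finset.
Context {R : realType} {n : nat}.

(** If [I] and [J] differ but have equal size, some [i] in [I] lies outside [J], and row [i] of the
    submatrix is zero. Serves both the inverse metric in the Hodge star and the Jacobian of the
    identity. *)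
Lemma minor_diag (M : 'M[R]_n) (I J : {set 'I_n}) : is_diag_mx M ->
  minor M I J = if I == J then \prod_(i in I) M i i else 0.
Proof.
move=> /is_diag_mxP dM; rewrite /minor; case: eqP => [eqIJ|neIJ]; last first.
  by case: eqP => // IJ; case: neIJ; rewrite IJ.
case: eqP => [IJ|/eqP IJ].
  move: eqIJ; rewrite -IJ => eqIJ.
  rewrite [LHS](_ : _ = \det (diag_mx (\row_(a < #|I|)
      M (enum_val a) (enum_val a)))); last first.
    congr (\det _); apply/matrixP => a b; rewrite !mxE.
    have -> : cast_ord eqIJ b = b by apply: val_inj.
    have [->|ab] := eqVneq a b; first by rewrite mulr1n.
    rewrite mulr0n dM//; apply: contra ab => /eqP/val_inj/enum_val_inj ->.
    exact: eqxx.
  rewrite det_diag.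
  under eq_bigr do rewrite mxE.
  by rewrite -(big_enum_val (op := *%R) (fun i => M i i)).
have [i iI iJ] : exists2 i, i \in I & i \notin J.
  apply/subsetPn; apply: contra IJ => sIJ; by rewrite eqEcard sIJ eqIJ leqnn.
rewrite (expand_det_row _ (enum_rank_in iI i)) big1// => b _.
rewrite mxE enum_rankK_in// dM ?mul0r//; apply: contra iJ => /eqP/val_inj ->.
exact: enum_valP.
Qed.

End Minors.

(** * Linearity of the wedge and interior products *)

Section Wedge.
Import mathcomp.boot.fintype mathcomp.boot.finset.
Context {R : realType} {n : nat}.
Implicit Types a b c : ext R n.

Lemma wedgeDl a b c : (a + b) /\w c = a /\w c + b /\w c.
Proof.
apply/ffunP => K; rewrite !ffunE -big_split; apply: eq_bigr => I _.
by rewrite ffunE mulrDr mulrDl.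
Qed.

Lemma wedgeDr a b c : a /\w (b + c) = a /\w b + a /\w c.
Proof.
apply/ffunP => K; rewrite !ffunE -big_split; apply: eq_bigr => I _.
by rewrite ffunE mulrDr.
Qed.

Lemma wedgeZl (k : R) a b : (k *: a) /\w b = k *: (a /\w b).
Proof.
apply/ffunP => K; rewrite !ffunE scaler_sumr; apply: eq_bigr => I _.
by rewrite ffunE /GRing.scale /= mulrCA -!mulrA.
Qed.

Lemma wedgeZr (k : R) a b : a /\w (k *: b) = k *: (a /\w b).
Proof.
apply/ffunP => K; rewrite !ffunE scaler_sumr; apply: eq_bigr => I _.
by rewrite ffunE /GRing.scale /= mulrCA.
Qed.

Lemma wedge0l a : (0 : ext R n) /\w a = 0.
Proof. by rewrite -(scale0r (0 : ext R n)) wedgeZl !scale0r. Qed.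

Lemma wedge0r a : a /\w (0 : ext R n) = 0.
Proof. by rewrite -(scale0r (0 : ext R n)) wedgeZr !scale0r. Qed.

Lemma interior_prodD i a b :
  interior_prod i (a + b) = interior_prod i a + interior_prod i b.
Proof.
apply/ffunP => K; rewrite !ffunE; case: ifP => _; first by rewrite addr0.
by rewrite mulrDr.
Qed.

Lemma interior_prodZ i (k : R) a :
  interior_prod i (k *: a) = k *: interior_prod i a.
Proof.
apply/ffunP => K; rewrite !ffunE; case: ifP => _; first by rewrite scaler0.
by rewrite /GRing.scale /= mulrCA.
Qed.

Lemma interior_prod0 i : interior_prod i (0 : ext R n) = 0.
Proof. by rewrite -(scale0r (0 : ext R n)) interior_prodZ !scale0r. Qed.

End Wedge.

(** * Symbolic calculus of forms with coefficients polynomial in u *)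

Section Monomials.
Import mathcomp.boot.fintype mathcomp.boot.finset.
Context {R : realType} {n : nat}.

(** Index sets are encoded by lists of naturals so that disjointness, signs and products can be
    evaluated by [vm_compute]. *)
Definition ordset (s : seq nat) : {set 'I_n} := [set i | val i \in s].

(* dx^I for I = ordset s; the list s need not be sorted *)
Definition mono (s : seq nat) : ext R n := [ffun I => (I == ordset s)%:R].

Definition disj (s t : seq nat) : bool :=
  all (fun i => ~~ ((i \in s) && (i \in t))) (iota 0 n).

Definition inversions (s t : seq nat) : nat :=
  sumn [seq sumn [seq nat_of_bool [&& i \in s, j \in t & (j < i)%N] | j <- iota 0 n]
       | i <- iota 0 n].

Lemma sum_iota (F : nat -> nat) : sumn [seq F i | i <- iota 0 n] = (\sum_(i < n) F i)%N.
Proof. by rewrite sumnE big_map -{1}(subn0 n) big_mkord. Qed.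

Lemma shuffle_sign_ordset (s t : seq nat) :
  shuffle_sign (ordset s) (ordset t) = (-1) ^+ inversions s t :> R.
Proof.
rewrite /shuffle_sign /inversions; congr (_ ^+ _).
rewrite sum_iota -sum1_card big_mkcond /=.
under [RHS]eq_bigr do rewrite sum_iota.
rewrite pair_bigA /=; apply: eq_bigr => -[i j] _.
by rewrite !inE; case: ifP.
Qed.

Lemma disjP (s t : seq nat) : disj s t = [disjoint ordset s & ordset t].
Proof.
apply/allP/idP => [h|].
  rewrite -setI_eq0; apply/eqP/setP => i; rewrite !inE.
  by apply/negbTE/h; rewrite mem_iota /=.
rewrite -setI_eq0 => /eqP/setP h i; rewrite mem_iota /= add0n => i_n.
by have := h (Ordinal i_n); rewrite !inE /= => ->.
Qed.

Lemma ordset_cat s t : ordset (s ++ t) = ordset s :|: ordset t.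
Proof. by apply/setP => i; rewrite !inE mem_cat. Qed.

(** In the sum over [I] only [ordset s] survives; the other factor then requires [K] to be the
    disjoint union of the two index sets. *)
Lemma wedge_mono s t : mono s /\w mono t =
  if disj s t then (-1) ^+ inversions s t *: mono (s ++ t) else 0.
Proof.
apply/ffunP => K; rewrite ffunE.
have -> : (\sum_(I : {set 'I_n} | I \subset K)
    shuffle_sign I (K :\: I) * mono s I * mono t (K :\: I)) =
  (if ordset s \subset K then shuffle_sign (ordset s) (K :\: ordset s) *
     mono t (K :\: ordset s) else 0) :> R.
  rewrite big_mkcond (bigD1 (ordset s))//= big1 ?addr0.
    by case: ifP => // _; rewrite ffunE eqxx mulr1.
  by move=> I /negbTE neI; rewrite ffunE neI mulr0 mul0r if_same.
rewrite disjP ffunE; case: ifP => [sK|nsK].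
  have [E|NE] := eqVneq (K :\: ordset s) (ordset t).
    rewrite E; have dst : [disjoint ordset s & ordset t].
      by rewrite -E disjoint_sym disjoints_subset; apply/subsetP => x; rewrite !inE => /andP[].
    rewrite dst !ffunE ordset_cat -E.
    have -> : ordset s :|: K :\: ordset s = K.
      by rewrite -{1}(setIidPr sK) setID.
    by rewrite eqxx E shuffle_sign_ordset -[X in _ = X]/(_ * _).
  rewrite mulr0; case: ifP; last by rewrite ffunE.
  move=> dst; rewrite !ffunE ordset_cat; case: eqP => [E|]; last by rewrite scaler0.
  case/eqP: NE; rewrite E setDUl setDv set0U; apply/setDidPl.
  by rewrite disjoint_sym.
case: ifP; last by rewrite ffunE.
move=> dst; rewrite !ffunE ordset_cat; case: eqP => [E|]; last by rewrite scaler0.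
by move: nsK; rewrite E subsetUl.
Qed.

Lemma interior_mono (i : 'I_n) s : interior_prod i (mono s) =
  if val i \in s then (-1) ^+ inversions [:: val i] ([seq j <- s | j != val i]) *:
    mono ([seq j <- s | j != val i]) else 0.
Proof.
have E1 : ordset [:: val i] = [set i].
  by apply/setP => j; rewrite !inE.
have E2 : ordset ([seq j <- s | j != val i]) = ordset s :\ i.
  by apply/setP => j; rewrite !inE mem_filter.
apply/ffunP => K; rewrite ffunE -shuffle_sign_ordset E1 E2.
case: ifP => iK.
  case: ifP => is_; rewrite !ffunE // E2; case: eqP => [E|_]; last by rewrite scaler0.
  by move: iK; rewrite E !inE eqxx.
rewrite ffunE; case: ifP => is_; rewrite !ffunE; last first.
  case: eqP => [E|_]; last by rewrite mulr0.
  by move: is_; have := setU11 i K; rewrite E inE => ->.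
rewrite E2; have -> : (i |: K == ordset s) = (K == ordset s :\ i).
  apply/eqP/eqP => [<-|->]; last by rewrite setD1K// inE.
  by rewrite setU1K// iK.
by case: eqP => [->|_]; [rewrite -[X in _ = X]/(_ * _)|rewrite mulr0 scaler0].
Qed.

(* The term (b, k, s) of a list stands for (-1)^b u^k dx^s. *)
Definition term : Type := bool * nat * seq nat.
Definition tcoef (u : R) (x : term) : R := (-1) ^+ x.1.1 * u ^+ x.1.2.
Definition ev (u : R) (L : seq term) : ext R n :=
  \sum_(x <- L) tcoef u x *: mono x.2.

Definition twedge (x y : term) : seq term :=
  if disj x.2 y.2
  then [:: (x.1.1 (+) y.1.1 (+) odd (inversions x.2 y.2), (x.1.2 + y.1.2)%N, x.2 ++ y.2)]
  else [::].
Definition lwedge (L M : seq term) : seq term :=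
  flatten [seq flatten [seq twedge x y | y <- M] | x <- L].
Definition tint (i : nat) (x : term) : seq term :=
  if i \in x.2 then let s := [seq j <- x.2 | j != i] in
    [:: (x.1.1 (+) odd (inversions [:: i] s), x.1.2, s)]
  else [::].
Definition lint (i : nat) (L : seq term) : seq term :=
  flatten [seq tint i x | x <- L].

Lemma ev_cat u L M : ev u (L ++ M) = ev u L + ev u M.
Proof. exact: big_cat. Qed.

Lemma ev_nil u : ev u [::] = 0.
Proof. exact: big_nil. Qed.

Lemma ev_cons u x L : ev u (x :: L) = tcoef u x *: mono x.2 + ev u L.
Proof. exact: big_cons. Qed.

Lemma ev_twedge u x y :
  ev u (twedge x y) = (tcoef u x *: mono x.2) /\w (tcoef u y *: mono y.2).
Proof.
rewrite wedgeZl wedgeZr wedge_mono /twedge.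
case: ifP => _; last by rewrite ev_nil !scaler0.
rewrite ev_cons ev_nil addr0 !scalerA; congr (_ *: _).
rewrite /tcoef /= !signr_addb signr_odd exprD.
by move: (u ^+ _) (u ^+ _) ((-1) ^+ _) ((-1) ^+ _) ((-1) ^+ _) => *; ring.
Qed.

Lemma ev_lwedge u L M : ev u (lwedge L M) = ev u L /\w ev u M.
Proof.
elim: L => [|x L IH]; first by rewrite ev_nil wedge0l.
rewrite /lwedge /= ev_cat -/(lwedge L M) IH ev_cons wedgeDl; congr (_ + _).
elim: M {IH} => [|y M IH]; first by rewrite !ev_nil wedge0r.
by rewrite /= ev_cat IH ev_cons wedgeDr ev_twedge.
Qed.

Lemma ev_lint u (i : 'I_n) L : ev u (lint i L) = interior_prod i (ev u L).
Proof.
elim: L => [|x L IH]; first by rewrite ev_nil interior_prod0.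
rewrite /lint /= ev_cat -/(lint i L) IH ev_cons interior_prodD interior_prodZ.
congr (_ + _); rewrite interior_mono /tint.
case: ifP => _; last by rewrite ev_nil scaler0.
rewrite ev_cons ev_nil addr0 scalerA /tcoef /= signr_addb signr_odd.
by rewrite -mulrA [_ * u ^+ _]mulrC mulrA.
Qed.

Definition same (s t : seq nat) : bool :=
  all (fun i => (i \in s) == (i \in t)) (iota 0 n).

Lemma same_ordset s t : (ordset t == ordset s) = same s t.
Proof.
apply/eqP/allP => [/setP h i|h].
  rewrite mem_iota /= add0n => i_n.
  by have := h (Ordinal i_n); rewrite !inE /= => ->.
by apply/setP => i; rewrite !inE; apply/esym/eqP/h; rewrite mem_iota /=.
Qed.

(** The exponents of u, with multiplicity, in the terms of sign $(-1)^b$ that contribute to the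
    coefficient of $dx^t$. *)
Definition powers (b : bool) (t : seq nat) (L : seq term) : seq nat :=
  [seq x.1.2 | x <- L & (x.1.1 == b) && same x.2 t].

Lemma ev_powers u t L : ev u L (ordset t) =
  \sum_(k <- powers false t L) u ^+ k - \sum_(k <- powers true t L) u ^+ k.
Proof.
elim: L => [|[[b k] s] L IH]; first by rewrite ev_nil ffunE !big_nil subr0.
rewrite ev_cons ffunE IH ffunE ffunE same_ordset /powers /=.
case: (same s t); last by rewrite !andbF scaler0 add0r.
rewrite /tcoef /=; case: b; rewrite /= big_cons ?mulN1r ?mul1r.
  by rewrite -[X in X + _]/(_ * _) mulr1 opprD addrCA.
by rewrite -[X in X + _]/(_ * _) mulr1 addrA.
Qed.

(** Terms of opposite sign cancel in pairs, so an identity between coefficients, valid for every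
    value of u, reduces to a decidable comparison of multisets of exponents. *)
Lemma ev_eq u t L k m :
  perm_eq (powers false t L) (nseq m k ++ powers true t L) ->
  ev u L (ordset t) = u ^+ k *+ m.
Proof.
move=> h; rewrite ev_powers (perm_big _ h)/= big_cat /= addrK.
by rewrite big_nseq; elim: m {h} => //= m ->; rewrite mulrS.
Qed.

Lemma dcoord_ev u (i : 'I_n) : dcoord i = ev u [:: (false, 0%N, [:: val i])].
Proof.
rewrite ev_cons ev_nil addr0 /tcoef /= expr0 expr0 mul1r scale1r.
apply/ffunP => I; rewrite !ffunE; congr ((_ == _)%:R).
by apply/setP => j; rewrite !inE.
Qed.

Definition lscale (b : bool) (k : nat) (L : seq term) : seq term :=
  [seq (b (+) x.1.1, (k + x.1.2)%N, x.2) | x <- L].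

Lemma ev_lscale u b k L : ev u (lscale b k L) = ((-1) ^+ b * u ^+ k) *: ev u L.
Proof.
elim: L => [|x L IH]; first by rewrite ev_nil scaler0.
rewrite /= !ev_cons IH scalerDr scalerA /tcoef /= signr_addb exprD.
by congr (_ *: _ + _); rewrite -!mulrA; congr (_ * _); rewrite mulrCA.
Qed.

End Monomials.

(** * Metric, Hodge star and torsion of the structures in $\mathcal M_1$ *)

Section G2Structure.
Import mathcomp.boot.fintype mathcomp.boot.finset.
Context {R : realType}.

Definition lcoord (i : nat) : seq term := [:: (false, 0%N, [:: i])].

(** Symbolic form of [phi_of], with u as a formal variable: indices 0 to 2 are the $\theta^i$,
    indices 3 to 6 the $x_i$; [lscale true 0] is a minus sign and [lscale false 1] the factor u. *)
Definition lphi : seq term :=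
  let w := @lwedge 7 in
  w (w (lcoord 0) (lcoord 1)) (lcoord 2)
  ++ lscale true 0 (w (lcoord 0) (w (lcoord 3) (lcoord 4) ++ w (lcoord 5) (lcoord 6)))
  ++ lscale true 0 (w (lcoord 1) (w (lcoord 3) (lcoord 5) ++ w (lcoord 6) (lcoord 4)))
  ++ lscale true 0 (w (lcoord 2)
       (lscale false 1 (w (lcoord 3) (lcoord 6)) ++ w (lcoord 4) (lcoord 5))).

Lemma phi_of_ev (u : R -> R) (p : 'rV[R]_7) : phi_of u p = ev (u (p ord0 (inord 3))) lphi.
Proof.
set c := u _.
have dE k : (k < 7)%N -> dcoord (inord k) = ev c (lcoord k) :> ext R 7.
  by move=> k7; rewrite (dcoord_ev c) /= inordK.
rewrite /phi_of /dtheta /dx /= !dE// -/c /lphi.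
rewrite !(ev_cat, ev_lscale, ev_lwedge) !(expr0, expr1, mulr1, mul1r) !scaleN1r.
by rewrite !addrA.
Qed.

Definition lbilin (i j : nat) : seq term :=
  @lwedge 7 (@lwedge 7 (@lint 7 i lphi) (@lint 7 j lphi)) lphi.

(** The exponent of u in the i-th diagonal entry of B: it is 1 exactly for $\theta^3$, $x_0$, $x_3$,
    the coordinates in the term $u\,d\theta^3\wedge dx^{03}$. *)
Definition bexp (i : nat) : nat := i \in [:: 2; 3; 6]%N.

(** A finite check of the 49 entries of 6B, read off the top-degree monomial [iota 0 7]. The
    multiplicity 6 cancels the factor 1/6 in [g2_bilin]. *)
Lemma lbilin_powers : all (fun i => all (fun j =>
    perm_eq (@powers 7 false (iota 0 7) (lbilin i j))
      (nseq (if i == j then 6 else 0) (bexp i) ++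
       @powers 7 true (iota 0 7) (lbilin i j)))
  (iota 0 7)) (iota 0 7).
Proof. by vm_compute. Qed.

Lemma g2_bilin_phi (u : R -> R) (p : 'rV[R]_7) :
  g2_bilin (phi_of u p) =
    diag_mx (\row_i u (p ord0 (inord 3)) ^+ bexp i).
Proof.
set c := u _.
apply/matrixP => i j; rewrite !mxE phi_of_ev -/c -!ev_lint -!ev_lwedge.
have -> : [set: 'I_7] = ordset (iota 0 7).
  apply/setP => k; rewrite in_setT inE. by rewrite mem_iota /= add0n ltn_ord.
have i7 (k : 'I_7) : val k \in iota 0 7 by rewrite mem_iota /= add0n ltn_ord.
have /(ev_eq c) := allP (allP lbilin_powers _ (i7 i)) _ (i7 j).
rewrite -/(lbilin i j) => ->; rewrite val_eqE; case: eqP => _.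
  by rewrite mulr1n; move: (c ^+ _) => x; field.
by rewrite !mulr0n mulr0.
Qed.

Lemma det_g2_bilin_phi (u : R -> R) (p : 'rV[R]_7) :
  \det (g2_bilin (phi_of u p)) = u (p ord0 (inord 3)) ^+ 3.
Proof.
rewrite g2_bilin_phi det_diag.
under eq_bigr do rewrite mxE.
by rewrite -expr_sum !big_ord_recl big_ord0.
Qed.

(** Here det B = $u^3$ is positive, with ninth root $u^{1/3}$. *)
Lemma g2_vol_phi (u : R -> R) (p : 'rV[R]_7) : 0 < u (p ord0 (inord 3)) ->
  g2_vol (phi_of u p) = u (p ord0 (inord 3)) `^ 3^-1.
Proof.
move=> u0; rewrite /g2_vol det_g2_bilin_phi gtr0_sg ?exprn_gt0// mul1r.
rewrite ger0_norm ?exprn_ge0 ?ltW// -powR_mulrn ?ltW// -powRrM.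
by congr (_ `^ _); field.
Qed.

(* the indices of dtheta^2, dtheta^3, dx^2, dx^3 *)
Definition cross_set : {set 'I_7} := ordset [:: 1; 2; 5; 6]%N.

Lemma cross_setC : ~: cross_set = ordset [:: 0; 3; 4]%N.
Proof. by apply/setP => -[i Hi]; rewrite !inE; move: i Hi; do 7?case. Qed.

Lemma phi_cross_setC (u : R -> R) (p : 'rV[R]_7) : phi_of u p (~: cross_set) = -1.
Proof.
rewrite cross_setC phi_of_ev ev_powers.
have -> : @powers 7 false [:: 0; 3; 4]%N lphi = [::] by vm_compute.
have -> : @powers 7 true [:: 0; 3; 4]%N lphi = [:: 0]%N by vm_compute.
by rewrite big_nil big_seq1 sub0r.
Qed.

(** The metric is diagonal, so only the coefficient -1 of $d\theta^1\wedge dx^{01}$ in phi enters.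
    With $v = u^{1/3}$, the minor of the inverse metric on these three indices is $v^3/u = 1$, which
    leaves the volume factor v. *)
Lemma g2_star_cross (u : R -> R) (p : 'rV[R]_7) : 0 < u (p ord0 (inord 3)) ->
  g2_star (phi_of u p) (phi_of u p) cross_set =
    - shuffle_sign (~: cross_set) cross_set * u (p ord0 (inord 3)) `^ 3^-1.
Proof.
move=> u0; rewrite /g2_star /hodge ffunE /g2_metric g2_vol_phi// g2_bilin_phi.
set c := u _ in u0 *; set v := c `^ _.
have v0 : v != 0 by rewrite powR_eq0 gt_eqF.
have v3 : v ^+ 3 = c.
  by rewrite -powR_mulrn ?powR_ge0// -powRrM mulVf ?pnatr_eq0// powRr1 ?ltW.
have -> : invmx (v^-1 *: diag_mx (\row_i c ^+ bexp i)) =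
    diag_mx (\row_i (v / c ^+ bexp i)) :> 'M[R]_7.
  set M := _ *: _; set N := diag_mx _.
  have MN : M *m N = 1%:M.
    rewrite -scalemxAl mulmx_diag; apply/matrixP => i j; rewrite !mxE.
    case: eqP => _; rewrite ?mulr0n ?mulr0// !mulr1n.
    by field; rewrite v0 expf_neq0// gt_eqF.
  have [uM _] := mulmx1_unit MN.
  by rewrite -[RHS]mul1mx -(mulVmx uM) -mulmxA MN mulmx1.
rewrite (bigD1 (~: cross_set))//= big1 ?addr0; last first.
  move=> J /negbTE neJ; rewrite minor_diag ?diag_mx_is_diag//.
  by rewrite eq_sym neJ mul0r.
rewrite phi_cross_setC minor_diag ?diag_mx_is_diag// eqxx.
rewrite big_mkcond /= !big_ord_recl big_ord0 cross_setC !inE /= !mxE /=.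
rewrite /bexp /= !expr0 expr1 !mulr1n -v3.
by move: (shuffle_sign _ _) => s; field.
Qed.

Lemma derive_coord (G : R -> R) (p : 'rV[R]_7) (i : 'I_7) :
  'D_(delta_mx ord0 i) (fun q : 'rV[R]_7 => G (q ord0 (inord 3)) : R^o) p =
  if i == inord 3 then 'D_1 (G : R -> R^o) (p ord0 (inord 3)) else 0.
Proof.
rewrite /derive; case: eqVneq => [->|ne].
  rewrite [X in lim (fmap X _)](_ : _ = fun h : R => h^-1 *: (((G : R -> R^o)
    \o shift (p ord0 (inord 3))) (h *: 1) - G (p ord0 (inord 3)))) //.
  by apply/funext => h /=; rewrite !mxE !eqxx.
rewrite [X in lim (fmap X _)](_ : _ = cst 0); first exact: lim_cst.
apply/funext => h /=; rewrite !mxE eqxx eq_sym (negbTE ne) mulr0 add0r subrr.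
by rewrite scaler0.
Qed.

(** The star of phi depends on $x_0$ alone, so the coefficient of its differential on $x_0$ together
    with [cross_set] is a single $x_0$-derivative, that of $u^{1/3}$ up to sign. *)
Lemma torsion_free_derive (u : R -> R) : (forall x, 0 < u x) ->
  (forall x : R, derivable (fun y => u y `^ 3^-1 : R^o) x 1) ->
  torsion_free (phi_of u) -> forall x : R, 'D_1 (fun y => u y `^ 3^-1 : R^o) x = 0.
Proof.
move=> u0 du [_ dstar] x.
pose st (y : R) := phi_of u (const_mx y).
have starE (K : {set 'I_7}) : (fun q => g2_star (phi_of u q) (phi_of u q) K) =
    (fun q => g2_star (st (q ord0 (inord 3))) (st (q ord0 (inord 3))) K).
  by apply/funext => q; rewrite /st /phi_of !mxE.
have i3K : inord 3 \notin cross_set by rewrite inE /= inordK.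
have := congr1 (fun w : torus_form R 6 => w (const_mx x) (inord 3 |: cross_set)) dstar.
rewrite /d_ext /= !ffunE (bigD1 (inord 3)) ?setU11//= big1 ?addr0; last first.
  move=> i /andP[_ ne]; rewrite starE.
  by rewrite (derive_coord (fun y => g2_star (st y) (st y) _)) (negbTE ne) mulr0.
rewrite setU1K// starE (derive_coord (fun y => g2_star (st y) (st y) _)) eqxx mxE.
set s := shuffle_sign (~: cross_set) cross_set : R.
have -> : (fun y => g2_star (st y) (st y) cross_set) = (fun y => - s *: (u y `^ 3^-1 : R^o)).
  by apply/funext => y; rewrite g2_star_cross// ?mxE.
move/eqP; rewrite mulf_eq0 signr_eq0 /= => /eqP.
rewrite deriveZ//= => /eqP; rewrite scaler_eq0 oppr_eq0 signr_eq0 /= => /eqP.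
exact.
Qed.

Lemma torsion_free_eq1 (u : R -> R) : in_M1 u ->
  torsion_free (phi_of u) -> u = cst 1.
Proof.
move=> [smu _ u0 intu] tf.
have du (x : R) : derivable u x 1.
  by apply: diff_derivable; have [] := smu 1%N.
pose g (y : R) : R := u y `^ 3^-1.
(* A vanishing ['D_1] says something only where the limit exists, so derivability of $u^{1/3}$ is
   established first, from u > 0. *)
have dg (x : R) : derivable (g : R -> R^o) x 1.
  have dux : is_derive x 1 u ('D_1 u x) by exact: derivableP.
  have dp : is_derive (u x) 1 (fun z : R => z `^ 3^-1) (3^-1 * u x `^ (3^-1 - 1)).
    by apply: is_derive1_powR; exact: u0.
  exact: (@ex_derive _ _ _ _ _ _ _ (is_derive1_comp dp dux)).
have dg0 (x : R) : is_derive x 1 g 0.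
  rewrite -(torsion_free_derive u0 dg tf x); exact: derivableP.
have gE x : u x = g x ^+ 3.
  rewrite -powR_mulrn ?powR_ge0// -powRrM mulVf ?pnatr_eq0// powRr1//.
  exact: ltW.
have cu : u = cst (u 0).
  by apply/funext => x; rewrite gE (is_derive_0_is_cst x 0 dg0) -gE.
have m1 : @lebesgue_measure R `[0, 1]%classic = 1%E.
  by rewrite lebesgue_measure_itv/= lte_fin ltr01 oppr0 adde0.
by move: intu; rewrite /int_S1 cu Rintegral_cst//= m1 mulr1 => ->.
Qed.

End G2Structure.

(** * The identity as a diffeomorphism of the torus and of the circle *)

Section Identity.
Context {R : realType}.

Lemma smooth_cst (V W : normedModType R) (w : W) : smooth (cst w : V -> W).
Proof.
move=> k; elim: k w => [|k IH] w /=; first exact: cst_continuous.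
split=> // v; rewrite (_ : 'D_v (cst w) = cst 0).
  exact: IH.
by apply/funext => x; rewrite derive_cst.
Qed.

Lemma smooth_id (V : normedModType R) : smooth (@id V).
Proof.
case=> [|k] /=; first by move=> x; exact: cvg_id.
split=> // v; rewrite (_ : 'D_v id = cst v).
  exact: smooth_cst.
by apply/funext => x; rewrite derive_id.
Qed.

Lemma torus_diffeo_id (n : nat) : torus_diffeo (@id 'rV[R]_n.+1).
Proof.
have id_map : torus_map (@id 'rV[R]_n.+1) by split=> //; exact: smooth_id.
by split=> //; exists id.
Qed.

Lemma jacobian_id (n : nat) (p : 'rV[R]_n.+1) : jacobian_mx id p = 1%:M.
Proof.
by apply/matrixP => j i; rewrite !mxE derive_id mxE eqxx eq_sym.
Qed.

Lemma pullback_id (n : nat) (w : torus_form R n) : pullback id w = w.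
Proof.
apply/funext => p; apply/ffunP => I; rewrite ffunE jacobian_id.
rewrite (bigD1 I)//= big1 ?addr0.
  rewrite minor_diag ?scalar_mx_is_diag// eqxx big1 ?mul1r// => i _.
  by rewrite mxE eqxx.
by move=> J /negbTE neJ; rewrite minor_diag ?scalar_mx_is_diag// neJ mul0r.
Qed.

Lemma S1_diffeo_op_id : S1_diffeo_op (@id R).
Proof.
have id_map : S1_map_deg1 (@id R) by split=> //; exact: smooth_id.
split=> //; last by exists id.
by move=> x; rewrite derive1E derive_id.
Qed.

End Identity.

(** * Partial derivatives, mean value estimates and derivatives along curves *)

Section Analysis.
Local Open Scope classical_set_scope.
Context {R : realType}.
Local Notation mu := (@lebesgue_measure R).

Lemma is_derive_fst (G : R * R -> R) (t x : R) : differentiable G (t, x) ->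
  is_derive t 1 (fun s => G (s, x)) ('D_(1, 0) G (t, x)).
Proof.
move=> /diff_derivable dG.
have E : (fun h : R => h^-1 *: ((G \o shift (t, x)) (h *: (1, 0)) - G (t, x))) =
    (fun h : R => h^-1 *: (((fun s => G (s, x)) \o shift t) (h *: 1) - G (t, x))).
  apply/funext => h /=; have -> : h *: (1, 0) + (t, x) = (h *: 1 + t, x) :> R * R.
    by apply/pair_equal_spec; split=> //=; rewrite scaler0 add0r.
  by [].
split; first by have := dG (1, 0); rewrite /derivable E.
by rewrite /derive E.
Qed.

Lemma is_derive_snd (G : R * R -> R) (t x : R) : differentiable G (t, x) ->
  is_derive x 1 (fun y => G (t, y)) ('D_(0, 1) G (t, x)).
Proof.
move=> /diff_derivable dG.
have E : (fun h : R => h^-1 *: ((G \o shift (t, x)) (h *: (0, 1)) - G (t, x))) =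
    (fun h : R => h^-1 *: (((fun y => G (t, y)) \o shift x) (h *: 1) - G (t, x))).
  apply/funext => h /=; have -> : h *: (0, 1) + (t, x) = (t, h *: 1 + x) :> R * R.
    by apply/pair_equal_spec; split=> //=; rewrite scaler0 add0r.
  by [].
split; first by have := dG (0, 1); rewrite /derivable E.
by rewrite /derive E.
Qed.

Lemma is_derive_continuous (f : R -> R) (x df : R) :
  is_derive x 1 f df -> {for x, continuous f}.
Proof. by move=> [dfx _]; apply/differentiable_continuous/derivable1_diffP. Qed.

Lemma continuous_snd (G : R * R -> R) (t : R) : continuous G ->
  continuous (fun y => G (t, y)).
Proof.
move=> cG s; apply: (@continuous_comp _ _ _ (fun y => (t, y)) G); last exact: cG.
exact: (@cvg_pair _ _ _ (nbhs s) (nbhs t) (nbhs s) _ _ _ (cst t) id (cvg_cst t) cvg_id).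
Qed.

(** By compactness; it supplies the constants that dominate the differentiated integrands. *)
Lemma rectangle_bound (G : R * R -> R) (a b c d : R) : continuous G ->
  exists2 M, 0 <= M & forall s y, a <= s <= b -> c <= y <= d ->
    `|G (s, y)| <= M.
Proof.
move=> cG.
have cpt : compact (`[a, b] `*` `[c, d]) by apply: compact_setX; exact: segment_compact.
have cGw : {within `[a, b] `*` `[c, d], continuous G} by exact: continuous_subspaceT.
have /compact_bounded[M [Mr HM]] := continuous_compact cGw cpt.
exists (`|M| + 1); first by rewrite addr_ge0.
move=> s y sab ycd; apply: HM; first by rewrite (le_lt_trans (ler_norm M))// ltrDl.
by exists (s, y) => //; split; rewrite /= in_itv.
Qed.

Lemma continuous_within_segment (f : R -> R) (a b : R) :
  (forall y, a <= y <= b -> {for y, continuous f}) ->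
  {within `[a, b], continuous f}.
Proof.
move=> cf; apply: continuous_in_subspaceT => y.
by rewrite inE /= in_itv /=; exact: cf.
Qed.

Lemma integrable_segment (f : R -> R) (a b : R) :
  (forall y, a <= y <= b -> {for y, continuous f}) ->
  mu.-integrable `[a, b] (EFin \o f).
Proof.
move=> cf; apply: continuous_compact_integrable; first exact: segment_compact.
exact: continuous_within_segment.
Qed.

Lemma MVT_le (f df : R -> R) (a b : R) : a <= b ->
  (forall x, a <= x <= b -> is_derive x 1 f (df x)) ->
  exists2 x, a <= x <= b & f b - f a = df x * (b - a).
Proof.
move=> ab dfx; have [x xab fE] : exists2 x, x \in `[a, b]%R & f b - f a = df x * (b - a).
  apply: MVT_segment => // [x xab|].
    by apply: dfx; move: xab; rewrite in_itv /= => /andP[/ltW -> /ltW].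
  by apply: continuous_within_segment => x /dfx; exact: is_derive_continuous.
by exists x => //; move: xab; rewrite in_itv.
Qed.

(** The condition on x is symmetric around [a], so that a and b may come in either order. *)
Lemma MVT_between (f df : R -> R) (a b : R) :
  (forall x, `|x - a| <= `|b - a| -> is_derive x 1 f (df x)) ->
  exists2 x, `|x - a| <= `|b - a| & f b - f a = df x * (b - a).
Proof.
move=> dfx; have [ab|/ltW ba] := leP a b.
  have [x xab|x xab fE] := @MVT_le f df a b ab.
    by apply: dfx; rewrite !ger0_norm; lra.
  by exists x => //; rewrite !ger0_norm; lra.
have [x xab|x xab fE] := @MVT_le f df b a ba.
  by apply: dfx; rewrite !ler0_norm; lra.
exists x; first by rewrite !ler0_norm; lra.
by rewrite -[LHS]opprB fE; ring.
Qed.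

Lemma MVT_bound (f df : R -> R) (a b M : R) :
  (forall x, `|x - a| <= `|b - a| -> is_derive x 1 f (df x) /\ `|df x| <= M) ->
  `|f b - f a| <= M * `|b - a|.
Proof.
move=> h; have [x xab ->] := @MVT_between f df a b (fun x xab => (h x xab).1).
by rewrite normrM ler_wpM2r// (h x _).2.
Qed.

Lemma is_derive_eq0_cst (f : R -> R) (a b : R) : a <= b ->
  (forall x, a <= x <= b -> is_derive x 1 f 0) -> f b = f a.
Proof.
move=> ab h; have [x _ /eqP] := @MVT_le f (cst 0) a b ab h.
by rewrite mul0r subr_eq0 => /eqP.
Qed.

(* The difference quotient D of G s between X t and X s, extended by Gx when
   X s = X t, is continuous at t by the mean value theorem, and
   G s (X s) = G s (X t) + D s * (X s - X t). *)
Lemma is_derive_curve (G Gx : R -> R -> R) (X : R -> R) (t Gt X' : R) :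
  (forall s x : R, is_derive x 1 (G s) (Gx s x)) ->
  {for (t, X t), continuous (fun p : R * R => Gx p.1 p.2)} ->
  is_derive t 1 (fun s => G s (X t)) Gt -> is_derive t 1 X X' ->
  is_derive t 1 (fun s => G s (X s)) (Gt + X' * Gx t (X t)).
Proof.
move=> dG cGx dGt dX.
pose D s := if X s == X t then Gx s (X t) else (G s (X s) - G s (X t)) / (X s - X t).
have DE s : G s (X s) - G s (X t) = D s * (X s - X t).
  rewrite /D; case: eqP => [->|/eqP ne]; first by rewrite !subrr mulr0.
  by rewrite divfK// subr_eq0.
have DMVT s : exists2 x, `|x - X t| <= `|X s - X t| & D s = Gx s x.
  rewrite /D; case: eqP => [_|/eqP ne]; first by exists (X t); rewrite ?subrr ?normr0.
  have [x xX ->] := @MVT_between (G s) (Gx s) (X t) (X s) (fun x _ => dG s x).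
  by exists x => //; rewrite mulfK// subr_eq0.
have cX := is_derive_continuous dX.
have Dt : D t = Gx t (X t) by rewrite /D eqxx.
have cD : {for t, continuous D}.
  apply/cvgrPdist_lt => e e0.
  have /cvgrPdist_lt/(_ e e0)[[A B] /= [nA /nbhs_ballP[r /= r0 rB]] AB] := cGx.
  have /cvgrPdist_lt/(_ r r0) nX := cX.
  near=> s; rewrite Dt; have [x xs ->] := DMVT s.
  apply: (AB (s, x)); split=> /=; first by near: s.
  apply: rB; rewrite /ball /= distrC (le_lt_trans xs)// distrC.
  by near: s.
suff dK : is_derive t 1 (fun s => D s * (X s - X t)) (X' * Gx t (X t)).
  have -> : (fun s => G s (X s)) = (fun s => G s (X t)) + (fun s => D s * (X s - X t)).
    by apply/funext => s /=; rewrite fctE -DE; ring.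
  exact: is_deriveD.
have cK : (fun h : R => h^-1 *: (((fun s => D s * (X s - X t)) \o shift t) (h *: 1)
    - D t * (X t - X t))) @ 0^' --> X' * Gx t (X t).
  have -> : (fun h : R => h^-1 *: (((fun s => D s * (X s - X t)) \o shift t) (h *: 1)
      - D t * (X t - X t))) =
    (fun h : R => h^-1 *: ((X \o shift t) (h *: 1) - X t)) \* (D \o shift t).
    apply/funext => h /=; rewrite subrr mulr0 subr0 [h *: 1]mulr1.
    by rewrite -[h^-1 *: _]/(h^-1 * _) -[h^-1 *: _]/(h^-1 * _); ring.
  apply: cvgM.
    by have [dXt <-] := dX; exact: dXt.
  rewrite -Dt -[t in D t]add0r.
  apply: (@cvg_comp _ _ _ (shift t) D _ (nbhs (0 + t))).
    apply: cvg_within_filter; apply: cvgD; [exact: cvg_id|exact: cvg_cst].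
  by rewrite add0r.
split; first by apply/cvg_ex; exists (X' * Gx t (X t)).
by apply: cvg_lim => //; exact: cK.
Unshelve. all: by end_near. Qed.

End Analysis.

(** * Integrals with a parameter and primitives *)

Section Integrals.
Local Open Scope classical_set_scope.
Context {R : realType}.
Local Notation mu := (@lebesgue_measure R).

(** Differentiation under the integral sign on the open interval of radius d around t, dominated by
    the constant [|M|], which is integrable on a bounded segment. *)
Lemma is_derive_Rintegral (g dg : R -> R -> R) (a b t d M : R) : 0 < d ->
  (forall s y, `|s - t| < d -> a <= y <= b ->
     [/\ {for y, continuous (g s)}, is_derive s 1 (g ^~ y) (dg s y) &
         `|dg s y| <= M]) ->
  is_derive t 1 (fun s => \int[mu]_(y in `[a, b]) g s y)
    (\int[mu]_(y in `[a, b]) dg t y).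
Proof.
move=> d0 h.
have inI s : s \in `]t - d, t + d[%R -> `|s - t| < d.
  by rewrite in_itv /= ltr_norml => /andP[? ?]; apply/andP; split; lra.
have It : `]t - d, t + d[ t by rewrite /= in_itv /=; apply/andP; split; lra.
have intg s : `]t - d, t + d[ s -> mu.-integrable `[a, b] (EFin \o g s).
  move=> /inI ds; apply: integrable_segment => y yab.
  by have [] := h s y ds yab.
have derg s y : `]t - d, t + d[ s -> `[a, b] y -> derivable (g ^~ y) s 1.
  by move=> /inI ds; rewrite /= in_itv /= => yab; have [_ [? _] _] := h s y ds yab.
have pE s y : `]t - d, t + d[ s -> `[a, b] y -> partial1of2 g s y = dg s y.
  move=> /inI ds; rewrite /= in_itv /= => yab; have [_ [_ dgE] _] := h s y ds yab.
  by rewrite partial1of2E.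
have gub s y : `]t - d, t + d[ s -> `[a, b] y -> `|partial1of2 g s y| <= cst `|M| y.
  move=> Is yab; rewrite pE//; move: Is yab => /inI ds; rewrite /= in_itv /= => yab.
  by rewrite (le_trans _ (ler_norm M))//; have [] := h s y ds yab.
have intM : mu.-integrable `[a, b] (EFin \o cst `|M|).
  by apply: integrable_segment => y _; exact: cst_continuous.
have M0 (y : measurableTypeR R) : 0 <= cst `|M| y :> R by exact: normr_ge0.
have mab : measurable (`[a, b] : set (measurableTypeR R)) by exact: measurable_itv.
have dF := derivable_under_integral (mu := mu) mab It intg derg M0 intM gub.
split; first exact: dF.
rewrite -derive1E (differentiation_under_integral (mu := mu) mab It intg derg M0 intM gub).
apply: eq_Rintegral => y; rewrite inE => yab.
by rewrite -(pE _ _ It yab).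
Qed.

Lemma is_derive_int_from0 (f : R -> R) (x : R) : continuous f ->
  is_derive x 1 (int_from0 f) (f x).
Proof.
move=> cf.
have itf a b : mu.-integrable `[a, b] (EFin \o f).
  by apply: integrable_segment => y _; exact: cf.
have split_at a b c : a <= b -> b <= c ->
    \int[mu]_(y in `[a, c]) f y = \int[mu]_(y in `[a, b]) f y + \int[mu]_(y in `[b, c]) f y.
  move=> ab bc; apply/eqP; rewrite addrC -subr_eq; apply/eqP.
  rewrite (@Rintegral_itvB _ _ (BLeft a) (BRight c) b)// ?bnd_simp//.
  rewrite Rintegral_itv_obnd_cbnd//.
  by apply: integrableS (itf b c) => //; exact: subset_itv_oc_cc.
have int1 a : \int[mu]_(y in `[a, a]) f y = 0 by rewrite set_itv1 Rintegral_set1.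
have int0 a b : b < a -> \int[mu]_(y in `[a, b]) f y = 0.
  by move=> ba; rewrite set_itv_ge ?Rintegral_set0// bnd_simp -ltNge.
(* A base point below both x and 0: near x, [int_from0 f y] is [F y - F 0] whatever the sign of y,
   and x is interior for the fundamental theorem of calculus. *)
pose a := Num.min x 0 - 1.
have ax : a < x by rewrite /a; have := ge_min x x 0; rewrite lexx /=; lra.
have a0 : a < 0 by rewrite /a; have := ge_min 0 x 0; rewrite lexx orbT; lra.
pose F y := \int[mu]_(z in `[a, y]) f z.
have near_eq : {near x, (fun y => F y - F 0) =1 int_from0 f}.
  have : \forall y \near x, a < y by exact: lt_nbhsr.
  apply: filterS => y ay; rewrite /int_from0 /F; have [y0|y0] := leP y 0.
    rewrite (split_at a y 0)//; last exact: ltW.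
    move: y0; rewrite le_eqVlt => /predU1P[->|y0].
      by rewrite int1; ring.
    by rewrite (int0 0 y)//; ring.
  by rewrite (split_at a 0 y) ?(int0 y 0) ?ltW//; ring.
have [dF FE] : derivable F x 1 /\ F^`() x = f x.
  apply: (@continuous_FTC1_closed _ _ _ _ (x + 1)) => //; first by rewrite ltrDl.
  exact: cf.
apply: (near_eq_is_derive near_eq).
have dFx : is_derive x 1 F (f x) by rewrite -FE derive1E; exact: derivableP.
rewrite -[f x]subr0; apply: is_deriveB.
Qed.

Lemma int_from00 (f : R -> R) : int_from0 f 0 = 0.
Proof. by rewrite /int_from0 subrr. Qed.

Lemma int_from0_bound (f : R -> R) (M y : R) : continuous f ->
  (forall z, 0 <= z <= 1 -> `|f z| <= M) -> 0 <= y <= 1 ->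
  `|int_from0 f y| <= M.
Proof.
move=> cf fM y01.
have M0 : 0 <= M by apply: le_trans (fM 0 _); rewrite ?lexx ?ler01.
have [y0 y1] := andP y01.
have [z z0y] := MVT_le y0 (fun z _ => is_derive_int_from0 z cf).
rewrite int_from00 !subr0 => ->; rewrite normrM (ger0_norm y0).
have fz : `|f z| <= M by apply: fM; lra.
by rewrite (le_trans (ler_wpM2r y0 fz))// ler_piMr.
Qed.

Lemma is_derive_int_from0_param (f df : R * R -> R) (t x : R) :
  continuous f -> continuous df ->
  (forall s y : R, is_derive s 1 (fun r => f (r, y)) (df (s, y))) ->
  is_derive t 1 (fun s => int_from0 (fun y => f (s, y)) x)
    (int_from0 (fun y => df (t, y)) x).
Proof.
move=> cf cdf dfE.
have d (a b : R) : is_derive t 1 (fun s => \int[mu]_(y in `[a, b]) f (s, y))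
    (\int[mu]_(y in `[a, b]) df (t, y)).
  have [M M0 dfM] := rectangle_bound (t - 1) (t + 1) a b cdf.
  apply: (@is_derive_Rintegral (fun s y => f (s, y)) (fun s y => df (s, y)) _ _ _ 1 M) => //.
  move=> s y; rewrite ltr_norml => st yab; split.
  - exact: continuous_snd.
  - exact: dfE.
  - by apply: dfM => //; lra.
exact: is_deriveB.
Qed.

(** The minimum of f is attained, hence positive, and bounds the integral below by a positive
    constant. *)
Lemma Rintegral_segment_gt0 (f : R -> R) (a b : R) : a < b ->
  (forall y, a <= y <= b -> {for y, continuous f} /\ 0 < f y) ->
  0 < \int[mu]_(y in `[a, b]) f y.
Proof.
move=> ab h.
have [c] := EVT_min (ltW ab) (continuous_within_segment (fun y yab => (h y yab).1)).
rewrite in_itv /= => cab fc.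
have ic : mu.-integrable `[a, b] (EFin \o cst (f c)).
  by apply: integrable_segment => y _; exact: cst_continuous.
have ig : mu.-integrable `[a, b] (EFin \o f).
  by apply: integrable_segment => y /h[].
apply: (@lt_le_trans _ _ (\int[mu]_(y in `[a, b]) cst (f c) y)).
  have mab : mu `[a, b] = (b - a)%:E.
    by rewrite lebesgue_measure_itv/= lte_fin ab EFinB.
  by rewrite Rintegral_cst//= mab mulr_gt0 ?subr_gt0// (h c cab).2.
apply: le_Rintegral => // y /=; exact: fc.
Qed.

End Integrals.

(** * Linear scalar differential equations *)

Section Ode.
Local Open Scope classical_set_scope.
Context {R : realType}.

Lemma is_derive_affine (a b s : R) : is_derive s 1 (fun r => a - r * b) (- b).
Proof.
have dL : is_derive s 1 (id * cst b) (s *: 0 + b *: (1 : R)) by exact: is_deriveM.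
have dA : is_derive s 1 (cst a - id * cst b) (0 - (s *: 0 + b *: (1 : R))).
  exact: is_deriveB.
apply: (is_derive_eq dA).
by rewrite scaler0 !add0r [b *: 1]mulr1.
Qed.

Lemma continuous_curve (G : R * R -> R) (X : R -> R) (s : R) : continuous G ->
  {for s, continuous X} -> {for s, continuous (fun r => G (r, X r))}.
Proof.
move=> cG cX; apply: (@continuous_comp _ _ _ (fun r => (r, X r)) G); last exact: cG.
exact: (@cvg_pair _ _ _ (nbhs s) (nbhs s) (nbhs (X s)) _ _ _ id X cvg_id cX).
Qed.

(** A Gronwall argument. It is what makes h constant along the lines [X y], where the deviation of h
    from its initial value solves a linear equation. *)
Lemma linear_ode_eq0 (g a : R -> R) (T M : R) :
  (forall s, 0 <= s <= T -> is_derive s 1 g (a s * g s) /\ a s <= M) ->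
  g 0 = 0 -> forall t, 0 <= t <= T -> g t = 0.
Proof.
move=> h g0 t /andP[t0 tT].
(* g^2 e^(-2Ms) is nonincreasing on [0, T] *)
pose E := (fun s => g s ^+ 2) * (fun s => expR (0 - s * (2 * M))).
have dE s : 0 <= s <= t -> is_derive s 1 E
    (2 * (a s - M) * (g s ^+ 2 * expR (0 - s * (2 * M)))).
  move=> /andP[s0 st]; have [dg _] : is_derive s 1 g (a s * g s) /\ a s <= M.
    by apply: h; rewrite s0 (le_trans st).
  have de : is_derive s 1 (fun s => expR (0 - s * (2 * M)))
      (expR (0 - s * (2 * M)) * - (2 * M)).
    by have dA := is_derive_affine 0 (2 * M) s; exact: is_derive1_comp.
  have dg2 : is_derive s 1 (g ^+ 2) ((2 * g s ^+ 1) *: (a s * g s)).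
    exact: is_deriveX.
  rewrite /E (_ : (fun s => g s ^+ 2) = g ^+ 2); last by apply/funext.
  apply: (is_derive_eq (is_deriveM dg2 de)).
  by rewrite -![_ *: _]/(_ * _) fctE expr1; ring.
have [s /andP[s0 st]] := MVT_le t0 dE.
have as_ : a s - M <= 0.
  by have [|_] := h s; [rewrite s0 (le_trans st)|rewrite subr_le0].
rewrite /E !fctE g0 expr0n mul0r subr0 => gE.
have : g t ^+ 2 * expR (0 - t * (2 * M)) <= 0.
  have e0 : 0 <= g s ^+ 2 * expR (0 - s * (2 * M)).
    by rewrite mulr_ge0 ?sqr_ge0 ?expR_ge0.
  rewrite gE subr0; have := mulr_le0_ge0 (mulr_le0_ge0 as_ e0) t0.
  by move: (_ * expR _) => e; lra.
rewrite pmulr_lle0 ?expR_gt0// => g2.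
by apply/eqP; rewrite -sqrf_eq0 eq_le g2 sqr_ge0.
Qed.

End Ode.

(** * Canonical geodesics and their characteristics *)

Section SmoothPath.
Local Open Scope classical_set_scope.
Context {R : realType}.
Variable u : R -> R -> R.
Let U (p : R * R) : R := u p.1 p.2.
Hypothesis smu : smooth U.

Let ut : R * R -> R := 'D_(1, 0) U.
Let utt : R * R -> R := 'D_(1, 0) ut.
Let ux : R * R -> R := 'D_(0, 1) U.

Let U_diff p : differentiable U p.
Proof. by have [] := smu 1%N. Qed.

Let ut_diff p : differentiable ut p.
Proof. by have [_ /(_ (1, 0))[]] := smu 2%N. Qed.

Let ut_cont : continuous ut.
Proof. by move=> p; exact: differentiable_continuous. Qed.

Let utt_cont : continuous utt.
Proof. by have [_ /(_ (1, 0))[_ /(_ (1, 0))]] := smu 2%N. Qed.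

Let ux_cont : continuous ux.
Proof. by have [_ /(_ (0, 1))] := smu 1%N. Qed.

Let is_derive_ut (t x : R) : is_derive t 1 (u ^~ x) (ut (t, x)).
Proof. exact: (is_derive_fst (U_diff (t, x))). Qed.

Let is_derive_ux (t x : R) : is_derive x 1 (u t) (ux (t, x)).
Proof. exact: (is_derive_snd (U_diff (t, x))). Qed.

Let is_derive_utt (t x : R) : is_derive t 1 (fun s => ut (s, x)) (utt (t, x)).
Proof. exact: (is_derive_fst (ut_diff (t, x))). Qed.

Lemma dtE t : dt u t = fun x => ut (t, x).
Proof. by apply/funext => x; rewrite /dt derive1E; apply: derive_val. Qed.

Let F s x := int_from0 (fun y => ut (s, y)) x.
Let Ft s x := int_from0 (fun y => utt (s, y)) x.

Let is_derive_Fx (s x : R) : is_derive x 1 (F s) (ut (s, x)).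
Proof. by apply: is_derive_int_from0; exact: continuous_snd. Qed.

Let is_derive_Ft (t x : R) : is_derive t 1 (F ^~ x) (Ft t x).
Proof. by apply: is_derive_int_from0_param. Qed.

(** Positivity is given only for t in [0, 1], whereas t-derivatives at the end points involve a full
    neighbourhood. Compactness in y and a bound on $u_t$ yield a uniform lower bound there. *)
Lemma locally_positive t : (forall y, 0 <= y <= 1 -> 0 < u t y) ->
  exists2 d, 0 < d <= 1 & exists2 m, 0 < m &
    forall s y, `|s - t| < d -> 0 <= y <= 1 -> m <= u s y.
Proof.
move=> ut0.
have ucont y : 0 <= y <= 1 -> {for y, continuous (u t)}.
  by move=> _; exact: is_derive_continuous (is_derive_ux t y).
have [y0 y001 u_min] := EVT_min (@ler01 R) (continuous_within_segment ucont).
have m0 : 0 < u t y0 by apply: ut0; move: y001; rewrite in_itv.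
have [M M0 utM] := rectangle_bound (t - 1) (t + 1) 0 1 ut_cont.
pose m := u t y0 / 2.
have {}m0 : 0 < m by rewrite divr_gt0.
have M1 : 0 < M + 1 by rewrite ltr_wpDl.
(* The 1 keeps s in the rectangle where M bounds $u_t$; the quotient makes u vary by at most m, half
   of its minimum 2m at time t. *)
exists (Num.min 1 (m / (M + 1))).
  by rewrite lt_min ltr01 divr_gt0//= ge_min lexx.
exists m => // s y; rewrite lt_min => /andP[st1 std] y01.
have : `|u s y - u t y| <= M * `|s - t|.
  apply: (@MVT_bound _ (u ^~ y) (fun r => ut (r, y))) => r rt; split=> //.
  by apply: utM => //; move: (le_lt_trans rt st1); rewrite ltr_norml; lra.
have : M * `|s - t| <= m.
  rewrite (@le_trans _ _ ((M + 1) * `|s - t|))//.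
    by rewrite ler_wpM2r// lerDl.
  by move: std; rewrite ltr_pdivlMr// mulrC => /ltW.
have : u t y0 <= u t y by apply: u_min; rewrite in_itv.
have : u t y0 = 2 * m by rewrite /m; field.
rewrite ler_norml => *; lra.
Qed.

(** [derive1] is a total function; this turns the left side of the geodesic equation into a genuine
    derivative. Both integrals in Q are differentiated under the integral sign, and the denominator
    is positive at t. *)
Lemma derivable_Qop (t x : R) : (forall y, 0 <= y <= 1 -> 0 < u t y) ->
  derivable (fun s => Qop (u s) (dt u s) x) t 1.
Proof.
move=> ut0; have [d /andP[d0 d1] [m m0 um]] := locally_positive ut0.
have near1 s : `|s - t| < d -> t - 1 <= s <= t + 1.
  by rewrite ltr_norml; lra.
have uN0 s y : `|s - t| < d -> 0 <= y <= 1 -> u s y != 0.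
  by move=> sd y01; rewrite gt_eqF// (lt_le_trans m0)// um.
have Vm s y : `|s - t| < d -> 0 <= y <= 1 -> `|(u s y)^-1| <= m^-1.
  move=> sd y01; have mu := um s y sd y01; have u0 := lt_le_trans m0 mu.
  by rewrite ger0_norm ?invr_ge0 ?(ltW u0)// lef_pV2.
have [M M0 utM] := rectangle_bound (t - 1) (t + 1) 0 1 ut_cont.
have [M' M'0 uttM] := rectangle_bound (t - 1) (t + 1) 0 1 utt_cont.
have FM s y : `|s - t| < d -> 0 <= y <= 1 -> `|F s y| <= M.
  move=> /near1 s1 y01; apply: int_from0_bound => //; first exact: continuous_snd.
  by move=> z z01; exact: utM.
have FtM s y : `|s - t| < d -> 0 <= y <= 1 -> `|Ft s y| <= M'.
  move=> /near1 s1 y01; apply: int_from0_bound => //; first exact: continuous_snd.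
  by move=> z z01; exact: uttM.
have contV s y : `|s - t| < d -> 0 <= y <= 1 -> {for y, continuous (fun z => (u s z)^-1)}.
  move=> sd y01; apply: cvgV; first exact: uN0.
  exact: is_derive_continuous (is_derive_ux s y).
have derV (s y : R) : `|s - t| < d -> 0 <= y <= 1 ->
    is_derive s 1 (fun r => (u r y)^-1) (- (u s y) ^- 2 *: ut (s, y)).
  move=> sd y01; have [du <-] := is_derive_ut s y.
  split; first by apply: derivableV => //; exact: uN0.
  by rewrite deriveV//; exact: uN0.
have bdV s y : `|s - t| < d -> 0 <= y <= 1 -> `|- (u s y) ^- 2 *: ut (s, y)| <= m^-1 ^+ 2 * M.
  move=> sd y01; rewrite -[_ *: _]/(_ * _) normrM normrN -exprVn normrX.
  by apply: ler_pM; rewrite ?exprn_ge0// ?lerXn2r ?nnegrE ?invr_ge0 ?(ltW m0)// ?Vm// utM// near1.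
have dB : is_derive t 1 (fun s => int_S1 (fun y => (u s y)^-1))
    (\int[lebesgue_measure]_(y in `[0, 1]) (- (u t y) ^- 2 *: ut (t, y))).
  apply: (is_derive_Rintegral (g := fun s y => (u s y)^-1)
    (dg := fun s y => - (u s y) ^- 2 *: ut (s, y)) (M := m^-1 ^+ 2 * M) d0) => s y sd y01.
  by split; [exact: contV|exact: derV|exact: bdV].
have dA : is_derive t 1 (fun s => int_S1 (fun y => (u s y)^-1 * F s y))
    (\int[lebesgue_measure]_(y in `[0, 1])
       ((u t y)^-1 *: Ft t y + F t y *: (- (u t y) ^- 2 *: ut (t, y)))).
  apply: (is_derive_Rintegral (g := fun s y => (u s y)^-1 * F s y)
    (dg := fun s y => (u s y)^-1 *: Ft s y + F s y *: (- (u s y) ^- 2 *: ut (s, y)))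
    (M := m^-1 * M' + M * (m^-1 ^+ 2 * M)) d0) => s y sd y01.
  split.
  - apply: cvgM; first exact: contV.
    exact: is_derive_continuous (is_derive_Fx s y).
  - have dVs := derV s y sd y01; have dFs := is_derive_Ft s y.
    exact: is_deriveM.
  - rewrite (le_trans (ler_normD _ _))// lerD//.
      by rewrite -[_ *: _]/(_ * _) normrM ler_pM// ?Vm ?FtM.
    by rewrite -[F s y *: _]/(_ * _) normrM ler_pM// ?FM ?bdV.
have B0 : int_S1 (fun y => (u t y)^-1) != 0.
  rewrite gt_eqF//; apply: Rintegral_segment_gt0 => // y y01.
  by split; [apply: contV|rewrite invr_gt0 ut0]; rewrite ?subrr ?normr0.
have -> : (fun s => Qop (u s) (dt u s) x) = (F ^~ x)
    - (fun s => int_S1 (fun y => (u s y)^-1 * F s y)) *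
      (fun s => (int_S1 (fun y => (u s y)^-1))^-1).
  by apply/funext => s; rewrite /Qop dtE.
apply: derivableB; first by have [] := is_derive_Ft t x.
apply: derivableM; first by have [] := dA.
by apply: derivableV => //; have [] := dB.
Qed.

Let q s x := Qop (u s) (dt u s) x.
Let h s x := q s x / u s x.
(** The x-derivative of $h = q/u$ by the quotient rule, with $q_x = u_t$; equivalently $u_t =
    (uh)_x$. *)
Let hx (s x : R) : R := ut (s, x) / u s x - h s x * (ux (s, x) / u s x).

Let is_derive_qx (s x : R) : is_derive x 1 (q s) (ut (s, x)).
Proof.
rewrite (_ : q s = F s - cst (int_S1 (fun y => (u s y)^-1 * F s y) *
  (int_S1 (fun y => (u s y)^-1))^-1)).
  have dF := is_derive_Fx s x; rewrite -[ut (s, x)]subr0; exact: is_deriveB.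
by apply/funext => y; rewrite /q /Qop dtE.
Qed.

(** The quotient rule is arranged so that f / g reappears in the derivative, as h does in [hx]. *)
Lemma is_derive_quotient (f g : R -> R) (x df dg : R) : g x != 0 ->
  is_derive x 1 f df -> is_derive x 1 g dg ->
  is_derive x 1 (fun y => f y / g y) (df / g x - f x / g x * (dg / g x)).
Proof.
move=> g0 dfx dgx.
have dV : is_derive x 1 (fun y => (g y)^-1) (- (g x) ^- 2 *: dg).
  have [? <-] := dgx; split; [exact: derivableV|exact: deriveV].
have dM : is_derive x 1 (f * (fun y => (g y)^-1))
    (f x *: (- (g x) ^- 2 *: dg) + (g x)^-1 *: df) by exact: is_deriveM.
apply: (is_derive_eq (df := _) dM).
rewrite -![_ *: _]/(_ * _); field.
exact: g0.
Qed.

Hypothesis u_gt0 : forall t y, 0 <= t <= 1 -> 0 < u t y.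
Hypothesis geodesic : forall t x, 0 <= t <= 1 ->
  derive1 (fun s => q s x) t = q t x * dt u t x / u t x
    + u t x / 2 * derive1 (fun y => q t y ^+ 2 / u t y ^+ 2) x.

Let u_neq0 t y : 0 <= t <= 1 -> u t y != 0.
Proof. by move=> t01; rewrite gt_eqF// u_gt0. Qed.

Let is_derive_hx (t x : R) : 0 <= t <= 1 -> is_derive x 1 (h t) (hx t x).
Proof. by move=> t01; apply: is_derive_quotient; rewrite ?u_neq0. Qed.

(** The last term of the geodesic equation is $\frac u2 (h^2)_x = u h h_x$. *)
Let is_derive_qt (t x : R) : 0 <= t <= 1 ->
  is_derive t 1 (fun s => q s x) (h t x * ut (t, x) + u t x * h t x * hx t x).
Proof.
move=> t01.
have dq : derivable (fun s => q s x) t 1 by apply: derivable_Qop => y _; exact: u_gt0.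
split=> //; rewrite -derive1E geodesic// dtE derive1E.
have -> : (fun y => q t y ^+ 2 / u t y ^+ 2) = h t ^+ 2.
  by apply/funext => y; rewrite /h fctE expr_div_n.
have dh := is_derive_hx x t01.
rewrite deriveX; last by have [] := dh.
have [_ ->] := dh; rewrite /= expr1 -[_ *: _]/(_ * _) /h.
by field; exact: u_neq0.
Qed.

(* h = q / u solves Burgers' equation h_t = h h_x, hence is constant along the
   lines x = y - t h(0, y). *)
Let X y s := y - s * h 0 y.

Let is_derive_X (y t : R) : is_derive t 1 (X y) (- h 0 y).
Proof. exact: is_derive_affine. Qed.

Let is_derive_u_char (y t : R) :
  is_derive t 1 (fun s => u s (X y s)) (ut (t, X y t) - h 0 y * ux (t, X y t)).
Proof.
rewrite -mulNr.
apply: (is_derive_curve (G := u) (Gx := fun s x => ux (s, x))) => //.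
have -> : (fun p : R * R => ux (p.1, p.2)) = ux by apply/funext => -[].
exact: ux_cont.
Qed.

(** [q] is controlled through its partial derivatives, the one in x being the continuous [ut]; this
    is the setting of [is_derive_curve]. *)
Let is_derive_q_char (y t : R) : 0 <= t <= 1 ->
  is_derive t 1 (fun s => q s (X y s))
    (h t (X y t) * ut (t, X y t) + u t (X y t) * h t (X y t) * hx t (X y t)
     - h 0 y * ut (t, X y t)).
Proof.
move=> t01; rewrite -mulNr.
apply: (is_derive_curve (G := q) (Gx := fun s x => ut (s, x))) => //.
  have -> : (fun p : R * R => ut (p.1, p.2)) = ut by apply/funext => -[].
  exact: ut_cont.
exact: is_derive_qt.
Qed.

(** Burgers' equation along a line of slope $-h(0,y)$: the derivative is linear in the deviation $h
    - h(0,y)$. *)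
Let is_derive_h_char (y t : R) : 0 <= t <= 1 ->
  is_derive t 1 (fun s => h s (X y s))
    (hx t (X y t) * (h t (X y t) - h 0 y)).
Proof.
move=> t01; apply: is_derive_eq.
  apply: is_derive_quotient; [exact: u_neq0|exact: is_derive_q_char|exact: is_derive_u_char].
by rewrite /hx /h; field; rewrite !u_neq0// lexx ler01.
Qed.

Let z01 : 0 <= (0 : R) <= 1. Proof. by rewrite lexx ler01. Qed.
Let o01 : 0 <= (1 : R) <= 1. Proof. by rewrite lexx ler01. Qed.

(** Ensures that the coefficient of that linear equation has a maximum on [0, 1]. *)
Let hx_char_continuous (y t : R) : 0 <= t <= 1 ->
  {for t, continuous (fun s => hx s (X y s))}.
Proof.
move=> t01; have cX := is_derive_continuous (is_derive_X y t).
have cVu : {for t, continuous (fun s => (u s (X y s))^-1)}.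
  apply: cvgV; first exact: u_neq0.
  exact: is_derive_continuous (is_derive_u_char y t).
apply: cvgB; apply: cvgM => //; first exact: continuous_curve.
  exact: is_derive_continuous (is_derive_h_char y t01).
by apply: cvgM => //; exact: continuous_curve.
Qed.

Let h_char (y t : R) : 0 <= t <= 1 -> h t (X y t) = h 0 y.
Proof.
move=> t01; have [s s01 hxM] := EVT_max (@ler01 R)
  (continuous_within_segment (fun r r01 => hx_char_continuous (y := y) r01)).
apply/eqP; rewrite -subr_eq0; apply/eqP; move: t t01.
apply: (@linear_ode_eq0 _ (fun r => h r (X y r) - h 0 y)
  (fun r => hx r (X y r)) 1 (hx s (X y s))); last by rewrite /X mul0r subr0 subrr.
move=> r r01; split; last by apply: hxM; rewrite in_itv.
rewrite -[_ * _]subr0; have dh := is_derive_h_char y r01.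
exact: (is_deriveB (g := cst (h 0 y))).
Qed.

(** Obtained from [h_char] by differentiating in y, with $X_y = 1 - t h_x(0,y)$. *)
Let hx_char (y t : R) : 0 <= t <= 1 ->
  hx t (X y t) * (1 - t * hx 0 y) = hx 0 y.
Proof.
move=> t01; have dX : is_derive y 1 (fun z => X z t) (1 - t * hx 0 y).
  have dh0 : is_derive y 1 (t \*: h 0) (t *: hx 0 y).
    by have dh := is_derive_hx y z01; exact: is_deriveZ.
  exact: (is_deriveB (f := id)).
have dhX := is_derive1_comp (g := X ^~ t) (x := y) (is_derive_hx (X y t) t01) dX.
have [_ <-] := dhX; have [_ <-] := is_derive_hx y z01.
by congr ('D_1 _ y); apply/funext => z; rewrite /= h_char.
Qed.

(** Along the line $u_t - h(0,y) u_x = u h_x$, so the left side has s-derivative $u\,(h_x (1 - s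
    h_x(0,y)) - h_x(0,y))$, which is 0 by [hx_char]. *)
Let u_char (y t : R) : 0 <= t <= 1 -> u t (X y t) * (1 - t * hx 0 y) = u 0 y.
Proof.
move=> /andP[t0 t1].
pose w s := u s (X y s) * (1 - s * hx 0 y).
have -> : u 0 y = w 0 by rewrite /w /X !mul0r !subr0 mulr1.
apply: (@is_derive_eq0_cst _ w) => // s /andP[s0 st].
have s01 : 0 <= s <= 1 by rewrite s0 (le_trans st).
have dM : is_derive s 1 w (u s (X y s) *: - hx 0 y +
    (1 - s * hx 0 y) *: (ut (s, X y s) - h 0 y * ux (s, X y s))).
  have du := is_derive_u_char y s; have da := is_derive_affine 1 (hx 0 y) s.
  exact: is_deriveM.
apply: (is_derive_eq dM).
rewrite -![_ *: _]/(_ * _).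
have -> : ut (s, X y s) - h 0 y * ux (s, X y s) = u s (X y s) * hx s (X y s).
  by rewrite -(h_char y s01) /hx; field; exact: u_neq0.
rewrite [LHS](_ : _ = u s (X y s) * (hx s (X y s) * (1 - s * hx 0 y) - hx 0 y)).
  by rewrite hx_char// subrr mulr0.
by ring.
Qed.

Hypothesis u0 : u 0 = cst 1.
Hypothesis u1 : u 1 = cst 1.

Lemma constant_path t : 0 <= t <= 1 -> u t = u 0.
Proof.
(* With both densities equal to 1, [u_char] at time 1 reads $1 - h_x(0,y) = 1$. *)
have hx0 y : hx 0 y = 0.
  by have := u_char y o01; rewrite u0 u1 /cst; lra.
have h0E : h 0 = q 0 by apply/funext => y; rewrite /h u0 /cst divr1.
have ut0 y : ut (0, y) = 0.
  have [_ <-] := is_derive_qx 0 y; rewrite -h0E.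
  by have [_ ->] := is_derive_hx y z01.
(* The primitive of $u_t(0,\cdot)$ from 0 vanishes, and with it the weighted mean that Q
   subtracts. *)
have h0 y : h 0 y = 0.
  have F0 z : F 0 z = 0.
    have [r _] := MVT_between (a := 0) (b := z) (fun r _ => is_derive_Fx 0 r).
    by rewrite ut0 mul0r /F int_from00 subr0.
  rewrite h0E /q /Qop dtE -/(F 0 y) F0 sub0r (_ : int_S1 _ = 0) ?mul0r ?oppr0//.
  rewrite /int_S1 (@eq_Rintegral _ _ _ _ _ (cst 0)); first by rewrite Rintegral_cst// mul0r.
  by move=> z _ /=; rewrite -/(F 0 z) F0 mulr0.
(* The characteristics are now vertical, [X y s = y], so h keeps its initial value 0 at every y. *)
have q0 s y : 0 <= s <= 1 -> q s y = 0.
  move=> s01; have := h_char y s01; rewrite /X h0 mulr0 subr0 /h => /eqP.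
  by rewrite mulf_eq0 invr_eq0 (negbTE (u_neq0 _ s01)) orbF => /eqP.
move=> /andP[t0 t1]; apply/funext => y.
apply: (is_derive_eq0_cst (f := u ^~ y)) => // s /andP[s0 st].
have s01 : 0 <= s <= 1 by rewrite s0 (le_trans st).
have uts0 : ut (s, y) = 0.
  have [_ <-] := is_derive_qx s y.
  by rewrite (_ : q s = cst 0) ?derive_cst//; apply/funext => z; exact: q0.
by rewrite -uts0.
Qed.

End SmoothPath.

Theorem proposition5p19 (R : realType) :
  (forall u v : R -> R, in_M1 u -> in_M1 v ->
     torsion_free (phi_of u) -> torsion_free (phi_of v) ->
     exists S : 'rV[R]_7 -> 'rV[R]_7,
       torus_diffeo S /\ pullback S (phi_of u) = phi_of v) /\
  (forall u : R -> R -> R, canonical_geodesic u ->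
     torsion_free (phi_of (u 0)) -> torsion_free (phi_of (u 1)) ->
     exists sigma : R -> R -> R, forall t : R, 0 <= t <= 1 ->
       S1_diffeo_op (sigma t) /\ u t = u 0 \o sigma t).
Proof.
split=> [u v uM vM tfu tfv|u [smu uM geo] tf0 tf1].
  exists id; split; first exact: torus_diffeo_id.
  by rewrite pullback_id (torsion_free_eq1 uM tfu) (torsion_free_eq1 vM tfv).
have u_gt0 t y : 0 <= t <= 1 -> 0 < u t y by move=> /uM[_ _ + _]; exact.
have u0 : u 0 = cst 1 by apply: torsion_free_eq1 => //; apply: uM; rewrite lexx ler01.
have u1 : u 1 = cst 1 by apply: torsion_free_eq1 => //; apply: uM; rewrite lexx ler01.
exists (fun=> id) => t t01; split; first exact: S1_diffeo_op_id.
exact: (constant_path smu u_gt0 geo u0 u1 t01).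
Qed.
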